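(* For every integer $n \ge 10$ of the form $n = 6k + 4$ with $k$ a positive integer, we have $\mathbf{car}(n, 2) \ge 2^{(n - 4)/3}$.
   Context: A partial deterministic finite (semi-)automaton (partial DFA) is a triple $\mathcal{A} = (Q, \Sigma, \delta)$ with $Q$ a finite set of states, $\Sigma$ a finite alphabet, and $\delta \colon Q \times \Sigma \rightharpoonup Q$ a partial transition function, extended to words $\delta\colon Q \times \Sigma^* \rightharpoonup Q$ in the usual way ($\delta(q,\varepsilon)=q$, $\delta(q, wa) = \delta(\delta(q,w),a)$, undefined if any step is undefined). A word $w \in \Sigma^*$ is carefully synchronising for $\mathcal{A}$ if there is a state $q \in Q$ such that $\delta(p, w)$ is defined and equals $q$ for every $p \in Q$. $\mathbf{car}(n, m)$ denotes the maximum, over all partial DFAs with $n$ states and $m$ letters that admit at least one carefully synchronising word, of the length of a shortest carefully synchronising word. *)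

(* Defs.v *)
From mathcomp Require Import all_boot all_order.
From Stdlib Require Import ClassicalEpsilon.
Set Implicit Arguments. Unset Strict Implicit. Unset Printing Implicit Defensive.

Definition pdfa (n m : nat) := {ffun 'I_n * 'I_m -> option 'I_n}.

Definition delta_word n m (A : pdfa n m) (p : 'I_n) (w : seq 'I_m) : option 'I_n :=
  foldl (fun o a => obind (fun q => A (q, a)) o) (Some p) w.

Definition carefully_sync n m (A : pdfa n m) (w : seq 'I_m) : bool :=
  [exists q : 'I_n, [forall p : 'I_n, delta_word A p w == Some q]].

Definition has_cs_word n m (A : pdfa n m) : Prop :=
  exists w : seq 'I_m, carefully_sync A w.

Definition cs_of_length n m (A : pdfa n m) (l : nat) : bool :=
  [exists w : l.-tuple 'I_m, carefully_sync A w].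

Definition shortest_cs n m (A : pdfa n m) : nat :=
  match excluded_middle_informative (exists l, cs_of_length A l) with
  | left H => ex_minn H
  | right _ => 0
  end.

Definition has_cs_wordb n m (A : pdfa n m) : bool :=
  if excluded_middle_informative (has_cs_word A) then true else false.

Definition car (n m : nat) : nat :=
  \max_(A : pdfa n m | has_cs_wordb A) shortest_cs A.

(* Main.v *)
(** For k >= 2 the automaton simulates a binary counter written on a ring of
    R = 2k - 1 cells.  A configuration has one token per tape square; the token
    of square i occupies cell p - i, where p is the position of a head that
    always reads cell 0.  The letter [mov] shifts every token by 1 and advances
    the head upwards; the total letter [rst] shifts by -2 and marks every
    digit 1, a mark being removed by the next [mov] but decaying to the digit 0
    at the next [rst].  So the word [rst mov] takes the head one square down,
    while two consecutive resets erase the tape.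

    The window forces the head to run as follows.  Going up it keeps the digits
    0 and turns at the first 1, which becomes 0; going down it replaces each 0 by
    1 and turns at the first 1.  From the blank tape this fills the ring with
    ones, and afterwards the square at which the head turns upwards serves as the
    end marker of a binary counter of R - 1 digits that is decremented at each
    return.  The tokens never merge, except when two resets and a move are read
    while the head is at the marker and the two leading digits are 0.

    Lower bound: decrementing a counter whose lowest 1 is digit i costs 3i
    letters, so a digit i equal to 1 stands for 3(2^i - 1) letters still to be
    spent; no letter sequence spends this potential faster than the forced run,
    and three quarters of it are gone before the first merge.  Upper bound: the
    forced run merges one chosen token into its neighbour and only rotates the
    others; as R is odd, powers of [rst] realise all rotations, and R - 1 such
    rounds merge everything. *)
Require Import Defs.
From mathcomp Require Import all_boot all_order.
From HB Require Import structures.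
From Stdlib Require Import ClassicalEpsilon.
From mathcomp Require Import all_algebra.
From mathcomp Require Import zify ring.
Set Implicit Arguments. Unset Strict Implicit. Unset Printing Implicit Defensive.
Import GRing.Theory.

(** * Words acting on families of states; bounds on [car] from any finite state set *)

Section PartialAction.
Variables (L T : Type) (step : L -> T -> option T).

Fixpoint run (p : T) (w : seq L) : option T :=
  if w is a :: w' then obind (fun q => run q w') (step a p) else Some p.

Lemma run_cat p w1 w2 : run p (w1 ++ w2) = obind (fun q => run q w2) (run p w1).
Proof. by elim: w1 p => [|a w1 IH] p //=; case: (step a p) => //= q. Qed.

Definition carries I (s : I -> T) (w : seq L) (t : I -> T) :=
  forall i, run (s i) w = Some (t i).

Lemma carries_nil I (s : I -> T) : carries s [::] s. Proof. by []. Qed.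

Lemma carries_cat I (s t u : I -> T) w1 w2 :
  carries s w1 t -> carries t w2 u -> carries s (w1 ++ w2) u.
Proof. by move=> h1 h2 i; rewrite run_cat h1 /= h2. Qed.

Lemma carries_ext I (s s' t t' : I -> T) w :
  s =1 s' -> t =1 t' -> carries s w t -> carries s' w t'.
Proof. by move=> es et h i; rewrite -es -et. Qed.

Lemma carries_comp I J (g : J -> I) (s t : I -> T) w :
  carries s w t -> carries (s \o g) w (t \o g).
Proof. by move=> h j; exact: h. Qed.

Definition syncs (w : seq L) := exists q, forall p, run p w = Some q.

End PartialAction.

Lemma delta_word_run n m (A : pdfa n m) p w :
  delta_word A p w = run (fun a q => A (q, a)) p w.
Proof.
rewrite /delta_word; elim: w p => [|a w IH] p //=.
by case: (A (p, a)) => [q|] /=; [exact: IH | elim: w {IH}].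
Qed.

Lemma carefully_syncP n m (A : pdfa n m) w :
  reflect (syncs (fun a q => A (q, a)) w) (carefully_sync A w).
Proof.
apply: (iffP existsP) => [[q /forallP h]|[q h]]; exists q.
  by move=> p; rewrite -delta_word_run; apply/eqP.
by apply/forallP => p; rewrite delta_word_run h.
Qed.

(** An enumeration of [T] transports the automaton, its runs and its synchronising words, so states
    may form a structured type. *)
Lemma car_lower_bound n m b (T : finType) (step : 'I_m -> T -> option T) :
  #|T| = n -> (exists w, syncs step w) ->
  (forall w, syncs step w -> b <= size w) -> b <= car n m.
Proof.
move=> cT [w0 sw0] hb.
pose enc (p : T) : 'I_n := cast_ord cT (enum_rank p).
pose dec (i : 'I_n) : T := enum_val (cast_ord (esym cT) i).
have encK : cancel enc dec by move=> p; rewrite /dec /enc cast_ordK enum_rankK.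
have decK : cancel dec enc by move=> i; rewrite /dec /enc enum_valK cast_ordKV.
pose A : pdfa n m := [ffun x => omap enc (step x.2 (dec x.1))].
have runA p w : run (fun a q => A (q, a)) (enc p) w = omap enc (run step p w).
  elim: w p => [|a w IH] p //=; rewrite ffunE /= encK.
  by case: (step a p) => //= q.
have syncA w : syncs (fun a q => A (q, a)) w <-> syncs step w.
  split=> -[q h].
    exists (dec q) => p; have := h (enc p); rewrite runA.
    by case: (run step p w) => //= s [<-]; rewrite encK.
  by exists (enc q) => p; rewrite -[p]decK runA h.
have hasA : has_cs_word A by exists w0; apply/carefully_syncP/syncA.
have hasbA : has_cs_wordb A.
  by rewrite /has_cs_wordb; case: excluded_middle_informative.
rewrite /car; apply: leq_trans (@leq_bigmax_cond _ _ (@shortest_cs n m) _ hasbA).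
rewrite /shortest_cs; case: excluded_middle_informative => [e|[]]; last first.
  exists (size w0); apply/existsP; exists (in_tuple w0).
  exact/carefully_syncP/syncA.
case: ex_minnP => l /existsP[w /carefully_syncP/syncA/hb].
by rewrite size_tuple.
Qed.

(** Witness: every letter is the successor map truncated at the last state. *)
Lemma car_ge_pred n m : 0 < m -> n.-1 <= car n m.
Proof.
case: n => [//|n] m_gt0 /=.
pose step (a : 'I_m) (p : 'I_n.+1) : option 'I_n.+1 := Some (inord (minn p.+1 n)).
have runE w (p : 'I_n.+1) : run step p w = Some (inord (minn (p + size w) n)).
  elim: w p => [|a w IH] p /=; have := ltn_ord p => lt_p.
    by congr Some; apply: val_inj; rewrite /= inordK; lia.
  rewrite IH inordK; last by lia.
  by congr (Some (inord _)); lia.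
apply: (@car_lower_bound _ _ _ _ step) => [|| w [q h]]; first exact: card_ord.
  exists (nseq n (Ordinal m_gt0)); exists ord_max => p.
  rewrite runE size_nseq; congr Some; apply: val_inj.
  by rewrite /= inordK; have := ltn_ord p; lia.
have := h ord0; rewrite -(h ord_max) !runE => -[/(congr1 val)].
by rewrite /= !inordK; lia.
Qed.

(** * The automaton *)

Local Open Scope ring_scope.

(** [r.+3] is the number of cells.  [ZeroIn] is the digit 0 in cell -1 just after
    a reset (one move away from being read by the descending head), [ZeroD] and
    [OneD] are the digits read by the descending head in cell 0.  [OneD] becomes
    [Hold] and then [Drop] under resets; [Guard1] and [Guard2] are reached by the
    two squares below the head when they carry a 1, and block the merge. *)
Inductive state (r : nat) :=
  | Zero of 'I_r.+3 | One of 'I_r.+3 | Marked of 'I_r.+3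
  | ZeroIn | ZeroD | OneD | Hold | Drop | Guard1 | Guard2.
Arguments ZeroIn {r}. Arguments ZeroD {r}. Arguments OneD {r}.
Arguments Hold {r}. Arguments Drop {r}. Arguments Guard1 {r}. Arguments Guard2 {r}.

Definition state_code r (s : state r) : (('I_r.+3 + 'I_r.+3) + 'I_r.+3) + 'I_7 :=
  match s with
  | Zero x => inl (inl (inl x)) | One x => inl (inl (inr x)) | Marked x => inl (inr x)
  | ZeroIn => inr (inord 0) | ZeroD => inr (inord 1) | OneD => inr (inord 2)
  | Hold => inr (inord 3) | Drop => inr (inord 4)
  | Guard1 => inr (inord 5) | Guard2 => inr (inord 6)
  end.

Definition state_decode r (u : (('I_r.+3 + 'I_r.+3) + 'I_r.+3) + 'I_7) : state r :=
  match u with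
  | inl (inl (inl x)) => Zero x | inl (inl (inr x)) => One x | inl (inr x) => Marked x
  | inr i => nth Guard2 [:: ZeroIn; ZeroD; OneD; Hold; Drop; Guard1; Guard2] i
  end.

Lemma state_codeK r : cancel (@state_code r) (@state_decode r).
Proof. by case=> //=; rewrite inordK. Qed.

Lemma state_decodeK r : cancel (@state_decode r) (@state_code r).
Proof.
case=> [[[x|x]|x]|i] //=; rewrite -[in RHS](inord_val i).
by case: i => -[|[|[|[|[|[|[|//]]]]]]] //=.
Qed.

HB.instance Definition _ r := Finite.copy (state r) (can_type (@state_codeK r)).

Lemma card_state r : #|{: state r}| = (3 * r.+3 + 7)%N.
Proof.
rewrite (bij_eq_card (Bijective (@state_codeK r) (@state_decodeK r))).
by rewrite !card_sum !card_ord; lia.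
Qed.

(** The states permuted by [reset_step]: the blank tape. *)
Definition idle r (x : 'I_r.+3) : state r := if x == -1 then ZeroIn else Zero x.

Definition reset_step r (s : state r) : state r :=
  match s with
  | Zero x => idle (x - 2)
  | One x => if x == 0 then idle (-2) else Marked (x - 2)
  | Marked x =>
      if x == -1 then Guard1 else if x == 0 then Guard2 else idle (x - 2)
  | ZeroIn => idle (-3)
  | ZeroD => Marked (-2)
  | OneD => Hold
  | Hold => Drop
  | Drop => idle (-6)
  | Guard1 => idle (-5)
  | Guard2 => idle (-4)
  end.

Definition move_step r (s : state r) : option (state r) :=
  match s with
  | Zero x => Some (Zero (x + 1))
  | One x => if x == 0 then None else Some (One (x + 1))
  | Marked x => Some (if x == -1 then OneD else One (x + 1))
  | ZeroIn => Some ZeroD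
  | OneD => Some (One 1)
  | Drop => Some (Zero (-2))
  | ZeroD | Hold | Guard1 | Guard2 => None
  end.

Definition rst : 'I_2 := ord0.
Definition mov : 'I_2 := ord_max.

Definition step r (a : 'I_2) (s : state r) : option (state r) :=
  if a == rst then Some (reset_step s) else move_step s.

(** State of a token with digit [b] in cell [x] when the head has arrived from
    below ([up_state]) or from above ([down_state]), one reset later
    ([marked_state]; [hold_state] if the descending head read a 1), and two resets
    later ([drop_state]). *)
Definition up_state r (b : bool) (x : 'I_r.+3) : state r := if b then One x else Zero x.
Definition down_state r (b : bool) (x : 'I_r.+3) : state r :=
  if x == 0 then (if b then OneD else ZeroD) else up_state b x.
Definition marked_state r (b : bool) (x : 'I_r.+3) : state r :=
  if b then Marked x else idle x.
Definition hold_state r (b : bool) (x : 'I_r.+3) : state r :=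
  if x == -2 then Hold else marked_state b x.
Definition drop_state r (e b : bool) (x : 'I_r.+3) : state r :=
  if e && (x == -4) then Drop else if b && (x == -3) then Guard1
  else if b && (x == -2) then Guard2 else idle x.

(** * Cells, and the effect of one letter on one token *)

(** A reset lowers the cell by 2 and a defined move raises it by 1, except that a move takes [Drop]
    from -4 to -2: this is the merge. *)
Definition cell r (s : state r) : 'I_r.+3 :=
  match s with
  | Zero x | One x | Marked x => x
  | ZeroIn => -1 | ZeroD | OneD => 0
  | Hold | Guard2 => -2 | Guard1 => -3 | Drop => -4
  end.

Lemma cell_idle r (x : 'I_r.+3) : cell (idle x) = x.
Proof. by rewrite /idle; case: eqP. Qed.

Lemma cell_up r (b : bool) (x : 'I_r.+3) : cell (up_state b x) = x.
Proof. by case: b. Qed.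

Lemma cell_down r (b : bool) (x : 'I_r.+3) : cell (down_state b x) = x.
Proof. by rewrite /down_state; case: eqP => [->|]; case: b. Qed.

Lemma cell_marked r (b : bool) (x : 'I_r.+3) : cell (marked_state b x) = x.
Proof. by case: b; rewrite /= ?cell_idle. Qed.

Lemma cell_hold r (b : bool) (x : 'I_r.+3) : cell (hold_state b x) = x.
Proof. by rewrite /hold_state; case: eqP => [->|] //; rewrite cell_marked. Qed.

Lemma cell_drop r (e b : bool) (x : 'I_r.+3) : cell (drop_state e b x) = x.
Proof.
rewrite /drop_state; case: ifP => [/andP[_ /eqP->] //|_].
case: ifP => [/andP[_ /eqP->] //|_]; case: ifP => [/andP[_ /eqP->] //|_].
exact: cell_idle.
Qed.

Lemma move_up r (b : bool) (x : 'I_r.+3) :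
  move_step (up_state b x) = if b && (x == 0) then None else Some (up_state b (x + 1)).
Proof. by case: b. Qed.

Lemma add1_eq0 r (x : 'I_r.+3) : (x + 1 == 0) = (x == -1).
Proof. by rewrite addr_eq0. Qed.

Lemma move_down r (b : bool) (x : 'I_r.+3) :
  move_step (down_state b x) = if ~~ b && (x == 0) then None else Some (up_state b (x + 1)).
Proof.
rewrite /down_state; case: ifP => [/eqP->|x0]; case: b => //=.
  by rewrite add0r.
by rewrite x0.
Qed.

Lemma move_idle r (x : 'I_r.+3) : move_step (idle x) = Some (down_state false (x + 1)).
Proof. by rewrite /idle /down_state add1_eq0; case: eqP. Qed.

Lemma move_marked r (b : bool) (x : 'I_r.+3) :
  move_step (marked_state b x) = Some (down_state b (x + 1)).
Proof. by case: b; rewrite /= ?move_idle // /down_state add1_eq0; case: ifP. Qed.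

Lemma reset_idle r (x : 'I_r.+3) : reset_step (idle x) = idle (x - 2).
Proof.
by rewrite /idle; case: eqP => [->|_] //=; congr idle; ring.
Qed.

Lemma reset_up r (b : bool) (x : 'I_r.+3) :
  reset_step (up_state b x) = marked_state (b && (x != 0)) (x - 2).
Proof. by case: b => //=; case: eqP => [->|_] //=; rewrite sub0r. Qed.

Lemma reset_down0 r (b : bool) (x : 'I_r.+3) : ~~ (b && (x == 0)) ->
  reset_step (down_state b x) = marked_state (b || (x == 0)) (x - 2).
Proof.
rewrite /down_state; case: ifP => [/eqP->|x0]; case: b => //= _.
- by rewrite sub0r.
- by rewrite x0.
Qed.

Lemma reset_down1 r (b : bool) (x : 'I_r.+3) : (x == 0 -> b) ->
  reset_step (down_state b x) = hold_state b (x - 2).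
Proof.
rewrite /down_state /hold_state; have -> : (x - 2 == -2) = (x == 0)
  by rewrite subr_eq addNr.
by case: ifP => [_ /(_ isT)->|x0 _] //=; case: b; rewrite /= ?x0.
Qed.

Lemma sub2_eq r (x y : 'I_r.+3) : (x - 2 == y) = (x == y + 2).
Proof. by rewrite subr_eq. Qed.

Lemma reset_marked r (b : bool) (x : 'I_r.+3) :
  reset_step (marked_state b x) = drop_state false b (x - 2).
Proof.
rewrite /drop_state !sub2_eq (_ : -3 + 2 = -1); last by ring.
rewrite (_ : -2 + 2 = 0); last by ring.
by case: b => //=; rewrite reset_idle.
Qed.

Lemma reset_hold r (b : bool) (x : 'I_r.+3) :
  reset_step (hold_state b x) = drop_state true b (x - 2).
Proof.
have E : (x - 2 == -4) = (x == -2).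
  by rewrite sub2_eq (_ : -4 + 2 = -2) //; ring.
rewrite /hold_state; case: ifP => x2; first by rewrite /drop_state E x2.
by rewrite reset_marked /drop_state /= E x2.
Qed.

Lemma reset_drop r (e b : bool) (x : 'I_r.+3) :
  reset_step (drop_state e b x) = idle (x - 2).
Proof.
rewrite /drop_state; case: ifP => [/andP[_ /eqP->]|_] /=; first by congr idle; ring.
case: ifP => [/andP[_ /eqP->]|_] /=; first by congr idle; ring.
case: ifP => [/andP[_ /eqP->]|_] /=; first by congr idle; ring.
exact: reset_idle.
Qed.

(** * Configurations of all tokens under single letters *)

Definition cfg r (g : bool -> 'I_r.+3 -> state r) (c : 'I_r.+3 -> bool) (p i : 'I_r.+3) :=
  g (c i) (p - i).

Definition upd r (c : 'I_r.+3 -> bool) (p : 'I_r.+3) (v : bool) : 'I_r.+3 -> bool :=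
  fun i => if i == p then v else c i.

Notation leads r := (@carries _ _ (@step r) _).

Lemma eq_cfg r g (c c' : 'I_r.+3 -> bool) p : c =1 c' -> cfg g c p =1 cfg g c' p.
Proof. by move=> e i; rewrite /cfg e. Qed.

Lemma sub_eq0 r (p i : 'I_r.+3) : (p - i == 0) = (i == p).
Proof. by rewrite subr_eq0 eq_sym. Qed.

Lemma up_by_move r (c : 'I_r.+3 -> bool) p :
  c p = false -> leads r (cfg (@up_state r) c p) [:: mov]
    (cfg (@up_state r) c (p + 1)).
Proof.
move=> cp i; rewrite /= /step /= move_up sub_eq0 /cfg.
by case: eqP => [->|_]; rewrite ?cp ?andbF /= addrAC.
Qed.

Lemma down_by_move r (c : 'I_r.+3 -> bool) p :
  c p -> leads r (cfg (@down_state r) c p) [:: mov] (cfg (@up_state r) c (p + 1)).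
Proof.
move=> cp i; rewrite /= /step /= move_down sub_eq0 /cfg.
by case: eqP => [->|_]; rewrite ?cp ?andbF /= addrAC.
Qed.

Lemma marked_by_move r (c : 'I_r.+3 -> bool) p :
  leads r (cfg (@marked_state r) c p) [:: mov] (cfg (@down_state r) c (p + 1)).
Proof. by move=> i; rewrite /= /step /= move_marked /cfg /= addrAC. Qed.

Lemma up_by_reset r (c : 'I_r.+3 -> bool) p :
  leads r (cfg (@up_state r) c p) [:: rst]
    (cfg (@marked_state r) (upd c p false) (p - 2)).
Proof.
move=> i; rewrite /= /step /= reset_up sub_eq0 /cfg /upd.
by congr (Some (marked_state _ _)); [case: eqP; rewrite ?andbF ?andbT | ring].
Qed.

Lemma down_by_reset0 r (c : 'I_r.+3 -> bool) p : c p = false ->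
  leads r (cfg (@down_state r) c p) [:: rst]
    (cfg (@marked_state r) (upd c p true) (p - 2)).
Proof.
move=> cp i; rewrite /= /step /= reset_down0 sub_eq0 /cfg /upd; last first.
  by case: eqP => [->|]; rewrite ?cp ?andbF.
by congr (Some (marked_state _ _)); [case: eqP; rewrite ?orbF ?orbT | ring].
Qed.

Lemma down_by_reset1 r (c : 'I_r.+3 -> bool) p : c p ->
  leads r (cfg (@down_state r) c p) [:: rst] (cfg (@hold_state r) c (p - 2)).
Proof.
move=> cp i; rewrite /= /step /= /cfg reset_down1; last by rewrite sub_eq0 => /eqP->.
by congr (Some (hold_state _ _)); ring.
Qed.

Lemma marked_by_reset r (c : 'I_r.+3 -> bool) p :
  leads r (cfg (@marked_state r) c p) [:: rst]
    (cfg (@drop_state r false) c (p - 2)).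
Proof.
by move=> i; rewrite /= /step /= reset_marked /cfg;
  congr (Some (drop_state _ _ _)); ring.
Qed.

Lemma hold_by_reset r (c : 'I_r.+3 -> bool) p :
  leads r (cfg (@hold_state r) c p) [:: rst] (cfg (@drop_state r true) c (p - 2)).
Proof.
by move=> i; rewrite /= /step /= reset_hold /cfg;
  congr (Some (drop_state _ _ _)); ring.
Qed.

Lemma drop_by_reset r e (c : 'I_r.+3 -> bool) p :
  leads r (cfg (@drop_state r e) c p) [:: rst]
    (cfg (@marked_state r) (fun=> false) (p - 2)).
Proof.
by move=> i; rewrite /= /step /= reset_drop /cfg /marked_state;
  congr (Some (idle _)); ring.
Qed.

Lemma turn_down r (c : 'I_r.+3 -> bool) p :
  leads r (cfg (@up_state r) c p) [:: rst; mov]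
    (cfg (@down_state r) (upd c p false) (p - 1)).
Proof.
have -> : p - 1 = p - 2 + 1 by ring.
exact: carries_cat (up_by_reset c p) (marked_by_move _ _).
Qed.

Lemma fill_down r (c : 'I_r.+3 -> bool) p : c p = false ->
  leads r (cfg (@down_state r) c p) [:: rst; mov]
    (cfg (@down_state r) (upd c p true) (p - 1)).
Proof.
have -> : p - 1 = p - 2 + 1 by ring.
by move=> cp; exact: carries_cat (down_by_reset0 cp) (marked_by_move _ _).
Qed.

(** * The binary counter on the ring *)

Definition tape r (m : 'I_r.+3) (b : nat -> bool) : 'I_r.+3 -> bool :=
  fun x => b (x - m : 'I_r.+3).

Lemma val_natr r j : (j < r.+3)%N -> (j%:R : 'I_r.+3) = j :> nat.
Proof. by move=> lt_j; rewrite Zp_nat /= modn_small. Qed.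

Lemma tape_nat r (m : 'I_r.+3) b j : (j < r.+3)%N -> tape m b (m + j%:R) = b j.
Proof. by move=> lt_j; rewrite /tape addrC addKr val_natr. Qed.

Lemma eq_tape r (m : 'I_r.+3) b b' :
  (forall j, (j < r.+3)%N -> b j = b' j) -> tape m b =1 tape m b'.
Proof. by move=> e x; apply: e. Qed.

Lemma upd_tape r (m : 'I_r.+3) b h v : (h < r.+3)%N ->
  upd (tape m b) (m + h%:R) v =1 tape m (fun j => if j == h then v else b j).
Proof.
move=> lt_h x; rewrite /upd /tape addrC -subr_eq.
by rewrite -(inj_eq (@ord_inj _)) val_natr.
Qed.

Definition between (a b j : nat) := (a <= j <= b)%N.

Lemma climb r (m : 'I_r.+3) b h : (h < r.+3)%N ->
    (forall j, between 1 h j -> b j = false) ->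
  leads r (cfg (@up_state r) (tape m b) (m + 1)) (nseq h mov)
    (cfg (@up_state r) (tape m b) (m + h.+1%:R)).
Proof.
elim: h => [|h IH] lt_h b0; first exact: carries_nil.
have -> : nseq h.+1 mov = nseq h mov ++ [:: mov] by rewrite -(nseqD h 1) addn1.
apply: carries_cat (IH _ _) _; first lia.
  by move=> j hj; apply: b0; move: hj; rewrite /between; lia.
rewrite [h.+2%:R]mulrSr addrA; apply: up_by_move.
by rewrite tape_nat // b0 // /between; lia.
Qed.

Definition set_digits (h : nat) (v : bool) (b : nat -> bool) (j : nat) :=
  if between 1 h j then v else b j.

Lemma descend r (m : 'I_r.+3) b h : (h < r.+3)%N ->
    (forall j, between 1 h j -> b j = false) ->
  leads r (cfg (@down_state r) (tape m b) (m + h%:R)) (flatten (nseq h [:: rst; mov]))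
    (cfg (@down_state r) (tape m (set_digits h true b)) m).
Proof.
elim: h b => [|h IH] b lt_h b0.
  apply: carries_ext (carries_nil _ _) => //; rewrite addr0.
  apply: eq_cfg; apply: eq_tape => j _.
  by rewrite /set_digits /between; case: ifP => //; lia.
rewrite (_ : flatten _ = [:: rst; mov] ++ flatten (nseq h [:: rst; mov])) //.
apply: carries_cat (fill_down _) _; first by rewrite tape_nat // b0 // /between leqnn.
pose b' j := if j == h.+1 then true else b j.
apply: carries_ext (IH b' _ _); last 2 first.
- lia.
- move=> j; rewrite /b' /between => hj; case: eqP => [|_]; first lia.
  by apply: b0; rewrite /between; lia.
- rewrite (_ : m + h.+1%:R - 1 = m + h%:R); last by rewrite mulrSr; ring.
  by apply: eq_cfg => x; rewrite upd_tape.
- apply: eq_cfg; apply: eq_tape => j _; rewrite /set_digits /b' /between.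
  by do ![case: ifP => //]; lia.
Qed.

Lemma tape0 r (m : 'I_r.+3) b : tape m b m = b 0%N.
Proof. by rewrite /tape subrr. Qed.

(** To clear one more digit: clear the lower ones, climb over them, turn at the top digit, which
    erases it, refill the lower ones while descending, and clear them again. *)
Lemma countdown r (m : 'I_r.+3) (b : nat -> bool) h : (h < r.+3)%N -> b 0%N ->
    (forall j, between 1 h j -> b j) ->
  exists w, leads r (cfg (@down_state r) (tape m b) m) w
    (cfg (@down_state r) (tape m (set_digits h false b)) m).
Proof.
elim: h b => [|h IH] b lt_h b0 b1.
  exists [::]; apply: carries_ext (carries_nil _ _) => //; apply: eq_cfg.
  by apply: eq_tape => j _; rewrite /set_digits /between; case: ifP => //; lia.
have zeros k k' c j : (k <= k')%N -> between 1 k j -> set_digits k' false c j = false.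
  by rewrite /set_digits /between => le_k hj; rewrite ifT //; lia.
have [||w1 h1] := IH b _ b0; first by lia.
  by move=> j hj; apply: b1; move: hj; rewrite /between; lia.
pose b2 := set_digits h.+1 false b.
have [|||w2 h2] := IH (set_digits h true b2); first by lia.
- by rewrite /b2 /set_digits.
- by move=> j; rewrite /set_digits => ->.
have turn : leads r (cfg (@up_state r) (tape m (set_digits h false b)) (m + h.+1%:R))
    [:: rst; mov] (cfg (@down_state r) (tape m b2) (m + h%:R)).
  apply: carries_ext (turn_down _ _) => //.
  rewrite (_ : m + h.+1%:R - 1 = m + h%:R); last by rewrite mulrSr; ring.
  apply: eq_cfg => x; rewrite upd_tape //; apply: eq_tape => j _.
  rewrite /b2 /set_digits /between; case: eqP => [->|ne]; first by rewrite leqnn.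
  by have -> : (0 < j <= h.+1)%N = (0 < j <= h)%N by lia.
exists (w1 ++ [:: mov] ++ nseq h mov ++ [:: rst; mov] ++
  flatten (nseq h [:: rst; mov]) ++ w2).
apply: carries_cat h1 _.
refine (carries_cat (down_by_move _) _); first by rewrite tape0.
refine (carries_cat (climb _ _ _) _); [by lia|by move=> j; apply: zeros|].
apply: carries_cat turn _.
refine (carries_cat (descend _ _ _) _); [by lia|by move=> j; apply: zeros|].
apply: carries_ext h2 => //; apply: eq_cfg; apply: eq_tape => j _.
rewrite /b2 /set_digits /between; case: (0 < j <= h)%N /idP => [hj|//].
by rewrite ifT //; lia.
Qed.

(** * Merging tokens and building a synchronising word *)

Definition glue r (m i : 'I_r.+3) := if i == m then m - 1 else i.

(** The token of [m] passes through [Hold] to [Drop], and the move shifts it by 2 onto its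
    neighbour; all other digits being 0, no guard blocks. *)
Lemma eat r (m : 'I_r.+3) :
  leads r (cfg (@down_state r) (pred1 m) m) [:: rst; rst; mov]
    (cfg (@down_state r) (fun=> false) (m - 3) \o glue m).
Proof.
have h1 := @down_by_reset1 r (pred1 m) m (eqxx m).
apply: (@carries_cat _ _ _ _ _ _ _ [:: rst] [:: rst; mov] h1).
apply: (@carries_cat _ _ _ _ _ _ _ [:: rst] [:: mov] (hold_by_reset _ _)).
move=> i; rewrite /= /step /= /cfg /drop_state /glue /=.
rewrite (_ : m - 2 - 2 - i = (m - i) - 4); last by ring.
have [->|ne] := eqVneq i m.
  rewrite subrr sub0r eqxx /=; congr Some; rewrite /down_state.
  by rewrite (_ : m - 3 - (m - 1) = -2) ?oppr_eq0 //; ring.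
have -> : (m - i - 4 == -4) = false.
  by rewrite subr_eq addNr sub_eq0; exact: negbTE.
by rewrite move_idle; congr (Some (down_state _ _)); ring.
Qed.

Lemma down_clear r (p : 'I_r.+3) :
  leads r (cfg (@down_state r) (fun=> false) p) [:: rst; rst; rst]
    (cfg (@marked_state r) (fun=> false) (p - 6)).
Proof.
have h0 := @down_by_reset0 r (fun=> false) p erefl.
apply: (@carries_cat _ _ _ _ _ _ _ [:: rst] [:: rst; rst] h0).
apply: (@carries_cat _ _ _ _ _ _ _ [:: rst] [:: rst] (marked_by_reset _ _)).
by have := drop_by_reset false (upd (fun=> false) p true) (p - 2 - 2);
  rewrite (_ : p - 2 - 2 - 2 = p - 6) //; ring.
Qed.

(** Fill the ring with ones, count down until only [m] carries a 1, merge there, and reset to the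
    blank tape. *)
Lemma round_word r (p : 'I_r.+3) : exists w,
  leads r (cfg (@marked_state r) (fun=> false) p) w
    (cfg (@marked_state r) (fun=> false) (p - 8) \o glue (p + 1)).
Proof.
pose m : 'I_r.+3 := p + 1.
have gap (y x : 'I_r.+3) : x != y -> (0 < (x - y)%R)%N.
  by rewrite -subr_eq0 lt0n.
(* With base [m + 1] the head, at [m], stands at the top height [r.+2]. The descent ends at [m + 1],
   and one last fill there brings the head back to [m]. *)
have start : leads r (cfg (@marked_state r) (fun=> false) p) [:: mov]
    (cfg (@down_state r) (tape (m + 1) (fun=> false)) (m + 1 + r.+2%:R)).
  apply: carries_ext (marked_by_move _ _) => //.
  rewrite (_ : m + 1 + r.+2%:R = p + 1) //.
  rewrite -addrA -mulrS (_ : r.+3%:R = 0) ?addr0 //.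
  by apply: val_inj; rewrite Zp_nat /= modnn.
have [||| w hw] := @countdown r m (fun=> true) r.+2 => //.
exists ([:: mov] ++ flatten (nseq r.+2 [:: rst; mov]) ++ [:: rst; mov] ++ w ++
  [:: rst; rst; mov] ++ [:: rst; rst; rst]).
apply: carries_cat start _.
refine (carries_cat (descend _ _ _) _) => //.
refine (carries_cat (fill_down _) _); first by rewrite tape0.
refine (carries_cat (carries_ext _ _ hw) _).
- rewrite addrK; apply: eq_cfg => x.
  rewrite /upd /tape /set_digits /between; case: eqP => // /eqP/gap.
  have := ltn_ord (x - (m + 1)) => lt_x gt_x.
  by rewrite ifT //; lia.
- by move=> i; reflexivity.
apply: carries_ext (carries_cat (eat m) (carries_comp _ (down_clear _))) => i.
- rewrite /cfg /tape /set_digits /between; congr down_state.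
  have [->|ne] := eqVneq i m; first by rewrite subrr /= eqxx.
  have := gap _ _ ne; have := ltn_ord (i - m) => lt_i gt_i.
  by rewrite [LHS](negbTE ne) ifT //; lia.
- by rewrite /= (_ : m - 3 - 6 = p - 8) // /m; ring.
Qed.

Lemma rotate r (p q : 'I_r.+3) : ~~ odd r ->
  exists w, leads r (cfg (@marked_state r) (fun=> false) p) w (cfg (@marked_state r) (fun=> false) q).
Proof.
move=> ev_r; pose F s := cfg (@marked_state r) (fun=> false) s.
have spin n : leads r (F p) (nseq n rst) (F (p - (2 * n)%:R)).
  elim: n => [|n IH].
    by apply: carries_ext (carries_nil _ _) => // i; rewrite muln0 subr0.
  have -> : nseq n.+1 rst = nseq n rst ++ [:: rst] by rewrite -(nseqD n 1) addn1.
  refine (carries_cat IH _) => i; rewrite /= /step /= reset_idle /F /cfg /=.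
  by congr (Some (idle _)); rewrite mulnS natrD; ring.
(* For even [r], [r./2 + 2] is the inverse of 2 modulo [r.+3]. *)
pose n := ((p - q)%R * (r./2 + 2))%N; exists (nseq n rst).
have -> : q = p - (2 * n)%:R; last exact: spin.
have -> : (2 * n = (p - q)%R * r.+3 + (p - q)%R)%N.
  by rewrite /n; have := odd_double_half r; rewrite (negbTE ev_r); nia.
rewrite natrD natrM (_ : r.+3%:R = 0) ?mulr0 ?add0r; last first.
  by apply: val_inj; rewrite Zp_nat /= modnn.
by rewrite natr_Zp subKr.
Qed.

Lemma glue_word r (a : 'I_r.+3) : ~~ odd r ->
  exists w, leads r (cfg (@marked_state r) (fun=> false) 0) w
    (cfg (@marked_state r) (fun=> false) 0 \o glue a).
Proof.
move=> ev_r; have [w1 h1] := @rotate r 0 (a - 1) ev_r.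
have [w2 h2] := round_word (a - 1).
have [w3 h3] := @rotate r (a - 1 - 8) 0 ev_r.
exists (w1 ++ w2 ++ w3); apply: carries_cat h1 (carries_cat h2 _).
by rewrite subrK; apply: carries_comp h3.
Qed.

(** Squares are glued from the top down: [minn i j] is the square whose token has absorbed token [i]
    once all squares above [j] are merged. *)
Lemma collapse_word r j : ~~ odd r -> (j < r.+3)%N ->
  exists w, leads r (cfg (@marked_state r) (fun=> false) 0 \o (fun i => (minn i j)%:R)) w
    (fun=> idle 0).
Proof.
move=> ev_r; elim: j => [|j IH] lt_j.
  exists [::]; apply: carries_ext (carries_nil _ _) => // i.
  by rewrite /= minn0 /cfg subr0.
have [w1 h1] := glue_word j.+1%:R ev_r.
have [w2 h2] := IH (ltnW lt_j).
exists (w1 ++ w2); refine (carries_cat (carries_comp _ h1) _).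
apply: carries_ext h2 => // i /=; congr cfg; rewrite /glue.
rewrite -(inj_eq (@ord_inj _)) !val_natr //; last by lia.
case: eqP => e; last by congr (_%:R); lia.
rewrite (_ : minn i j = j); last by lia.
by rewrite mulrSr addrK.
Qed.

Lemma reset_all r (s : state r) :
  exists x, run (@step r) s [:: rst; rst; rst] = Some (idle x).
Proof.
have marked (x : 'I_r.+3) : exists y, reset_step (reset_step (Marked x)) = idle y.
  rewrite /=; case: ifP => _ /=; first by eexists.
  by case: ifP => _ /=; [|rewrite reset_idle]; eexists.
suff [x ex] : exists x, reset_step (reset_step (reset_step s)) = idle x.
  by exists x; rewrite /= /step /= ex.
case: s => [x|x|x|||||||].
- by rewrite [reset_step (Zero x)]/= !reset_idle; eexists.
- rewrite [reset_step (One x)]/=; case: ifP => _; last exact: marked.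
  by rewrite !reset_idle; eexists.
- by have [y ->] := marked x; rewrite reset_idle; eexists.
- by rewrite [reset_step ZeroIn]/= !reset_idle; eexists.
- exact: marked.
- by eexists.
- by rewrite [reset_step Hold]/= [reset_step Drop]/= reset_idle; eexists.
- by rewrite [reset_step Drop]/= !reset_idle; eexists.
- by rewrite [reset_step Guard1]/= !reset_idle; eexists.
- by rewrite [reset_step Guard2]/= !reset_idle; eexists.
Qed.

Lemma sync_exists r : ~~ odd r -> exists w, syncs (@step r) w.
Proof.
move=> ev_r; have [w hw] := @collapse_word r r.+2 ev_r (ltnSn _).
exists ([:: rst; rst; rst] ++ w), (idle 0) => s.
rewrite run_cat; have [x ->] := reset_all s.
(* With the head at 0, [idle x] is the token of square [- x]. *)
rewrite [LHS](_ : _ = run (@step r) (idle x) w) // -[RHS](hw (- x)).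
congr run; rewrite /= /cfg /=; congr idle.
rewrite (_ : minn _ _ = (- x : 'I_r.+3)); last first.
  by have := ltn_ord (- x); rewrite /=; lia.
by rewrite natr_Zp sub0r opprK.
Qed.

(** * The potential of the counter and its invariants *)

(** [2 ^ j - 1] equals [j] plus the sum of [2 ^ i - 1] over [0 < i < j]: a decrement turning at
    digit [j] lowers the weight by [j]. *)
Definition weight r (b : nat -> bool) := (\sum_(1 <= j < r.+3) b j * (2 ^ j - 1))%N.

(** The extra 1 is paid by letters read before the ring is full; the final estimate needs it at
    [r = 0]. *)
Definition budget r := (3 * weight r (fun=> true) + 1)%N.

Lemma weight_upd r (b : nat -> bool) h (v : bool) : (0 < h < r.+3)%N ->
  (weight r (fun j => if j == h then v else b j) + b h * (2 ^ h - 1) =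
   weight r b + v * (2 ^ h - 1))%N.
Proof.
move=> hh; have mem : h \in index_iota 1 r.+3 by rewrite mem_index_iota.
rewrite /weight !(bigD1_seq h) ?iota_uniq //= eqxx.
rewrite (eq_bigr (fun j => b j * (2 ^ j - 1))%N) => [|j /negbTE-> //].
by rewrite addnC addnCA addnC.
Qed.

Lemma weight_top r (b : nat -> bool) : b r.+2 = false -> b r.+1 = false ->
  (weight r b + (2 ^ r.+1 - 1) + (2 ^ r.+2 - 1) <= weight r (fun=> true))%N.
Proof.
move=> b2 b1; rewrite /weight !(big_nat_recr r.+2) // !(big_nat_recr r.+1) //=.
rewrite b2 b1 !mul0n !mul1n !addn0 !leq_add2r.
by apply: leq_sum => j _; case: (b j).
Qed.

Definition counting r (c : 'I_r.+3 -> bool) (p : 'I_r.+3) (b : nat -> bool) m h :=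
  [/\ p = m + h%:R, b 0%N & c =1 tape m b].

(** In both invariants [t] is the number of letters read, [m] is the marker square
    and [h] the height of the head above it; [h = r.+3] in [inv_up] means that the
    head has come round to the marker.  The terms of [inv_down] depending on [h]
    account for the zeros the head is going to fill. *)
Definition inv_up r (c : 'I_r.+3 -> bool) (p : 'I_r.+3) (t : nat) : Prop :=
  exists b m h, [/\ counting c p b m h, (0 < h <= r.+3)%N,
    forall j, between 1 h.-1 j -> b j = false &
    (budget r + h <= t + 3 * weight r b)%N].

Definition inv_down r (c : 'I_r.+3 -> bool) (p : 'I_r.+3) (t : nat) : Prop :=
  (exists2 s, (s < r.+3)%N & c =1 tape p (between 1 s)) \/
  exists b m h, [/\ counting c p b m h, (h < r.+3)%N,
    forall j, between 1 h j -> b j = false &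
    (budget r <= t + 3 * weight r b + 3 * (2 ^ h.+1 - 2 - h) + 2 * h)%N].

Lemma natr_full r : r.+3%:R = 0 :> 'I_r.+3.
Proof. by apply: val_inj; rewrite Zp_nat /= modnn. Qed.

Lemma tape_pred r (p : 'I_r.+3) b :
  tape p b =1 tape (p - 1) (fun j => if j == 0%N then b r.+2 else b j.-1).
Proof.
move=> x; rewrite /tape; set y := x - p.
have -> : x - (p - 1) = y + 1 by rewrite /y; ring.
have lt_y := ltn_ord y; have -> : y + 1 = (y.+1)%:R by rewrite mulrSr natr_Zp.
have [y_max|] := eqVneq (y : nat) r.+2; first by rewrite y_max natr_full.
by move=> ne; rewrite val_natr //; lia.
Qed.

Lemma inv_down_blank r (p : 'I_r.+3) t : inv_down (fun=> false) p t.
Proof. by left; exists 0%N => // x; rewrite /tape /between; lia. Qed.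

Lemma eq_inv_down r (c c' : 'I_r.+3 -> bool) p t :
  c =1 c' -> inv_down c p t -> inv_down c' p t.
Proof.
move=> e [[s lt_s es]|[b [m [h [[h1 h2 h3] h4 h5 h6]]]]]; [left|right].
  by exists s => // x; rewrite -e.
by exists b, m, h; split=> //; split=> // x; rewrite -e.
Qed.

Lemma eq_upd r (c c' : 'I_r.+3 -> bool) p v : c =1 c' -> upd c p v =1 upd c' p v.
Proof. by move=> e x; rewrite /upd e. Qed.

Lemma inv_up_move r (c : 'I_r.+3 -> bool) p t :
  c p = false -> inv_up c p t -> inv_up c (p + 1) t.+1.
Proof.
move=> cp [b [m [h [[pE b0 cE] h_gt h_zero h_t]]]].
have lt_h : (h < r.+3)%N.
  rewrite ltn_neqAle; case/andP: h_gt => _ ->; rewrite andbT.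
  by apply/eqP => hE; move: cp; rewrite pE cE hE natr_full addr0 tape0 b0.
exists b, m, h.+1; split; last by lia.
- by split=> //; rewrite pE mulrSr addrA.
- by lia.
- move=> j hj; have [->|ne] := eqVneq j h.
    by rewrite -(tape_nat m b lt_h) -pE -cE.
  by apply: h_zero; move: hj; rewrite /between; lia.
Qed.

Lemma inv_down_move r (c : 'I_r.+3 -> bool) p t :
  c p -> inv_down c p t -> inv_up c (p + 1) t.+1.
Proof.
move=> cp [[s lt_s es]|[b [m [h [[pE b0 cE] lt_h h_zero h_t]]]]].
  by move: cp; rewrite es tape0.
have h0 : h = 0%N.
  case: h pE lt_h h_zero {h_t} => // h pE lt_h h_zero.
  by move: cp; rewrite cE pE tape_nat // h_zero // /between; lia.
exists b, m, 1%N; split=> //; last by move: h_t; rewrite h0; lia.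
  by split=> //; rewrite pE h0 addr0.
by move=> j; rewrite /between; lia.
Qed.

(** Erasing a 1 at height [h] loses [3 * (2 ^ h - 1)], made up exactly by the zeros to refill, the
    letters of the descent and the surplus [h]. Turning early, at a 0, loses nothing. *)
Lemma inv_up_turn r (c : 'I_r.+3 -> bool) p t :
  inv_up c p t -> inv_down (upd c p false) (p - 1) t.+2.
Proof.
move=> [b [m [h [[pE b0 cE] h_gt h_zero h_t]]]].
apply: eq_inv_down (fsym (eq_upd p false cE)) _.
(* At [h = r.+3] the turn erases the marker, the only 1 left. *)
have [hE|ne] := eqVneq h r.+3.
  rewrite pE hE natr_full addr0; apply: eq_inv_down (inv_down_blank _ _) => x.
  rewrite /upd /tape; case: eqP => // /eqP; rewrite -subr_eq0 => ne.
  have : (0 < (x - m)%R)%N by rewrite lt0n.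
  move: (ltn_ord (x - m)); move: (nat_of_ord _) => y lt_y y_gt.
  by rewrite h_zero // hE /between; lia.
have lt_h : (0 < h < r.+3)%N by lia.
right; exists (fun j => if j == h then false else b j), m, h.-1.
have := weight_upd b false lt_h; rewrite mul0n addn0 => wE.
case: h lt_h {h_gt ne} pE h_zero h_t wE => // h /= lt_h pE h_zero h_t wE; split.
- split=> [||x]; [by rewrite pE mulrSr; ring|by []|].
  by rewrite pE upd_tape.
- by lia.
- by move=> j hj; rewrite h_zero ?if_same.
- have : (h < 2 ^ h)%N by exact: ltn_expl.
  by move: wE; rewrite !expnS; case: (b h.+1); lia.
Qed.

(** While counting, the sum bounding [budget] is unchanged: the weight gained leaves the term in
    [h], and the 2 letters read leave [2 * h]. *)
Lemma inv_down_fill r (c : 'I_r.+3 -> bool) p t : c p = false ->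
  inv_down c p t -> inv_down (upd c p true) (p - 1) t.+2.
Proof.
move=> cp [[s lt_s es]|[b [m [h [[pE b0 cE] lt_h h_zero h_t]]]]].
  have cE : upd c p true =1 tape (p - 1)
      (fun j => if j == 0%N then s == r.+2 else (j <= s.+1)%N).
    have u := @upd_tape r p (between 1 s) 0 true isT.
    move=> x; rewrite addr0 in u; rewrite (eq_upd p true es) u tape_pred.
    apply: eq_tape => -[|[|j]] lt_j //=; rewrite /between //.
    by apply/andP/eqP; lia.
  (* For [s = r.+2] this fill completes the ring, and counting starts with marker [p - 1]. *)
  apply: eq_inv_down (fsym cE) _; have [sE|ne] := eqVneq s r.+2; [right|left].
    exists (fun=> true), (p - 1), 0%N; split=> //.
    - split=> //; first by rewrite addr0.
      by apply: eq_tape => -[|j] lt_j //=; rewrite sE; lia.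
    - by move=> j; rewrite /between; lia.
    - by rewrite /budget; lia.
  exists s.+1; first by lia.
  by apply: eq_tape => -[|j] lt_j //; rewrite /between; lia.
case: h pE lt_h h_zero h_t => [|h] pE lt_h h_zero h_t.
  by move: cp; rewrite cE pE addr0 tape0 b0.
right; exists (fun j => if j == h.+1 then true else b j), m, h.
have := weight_upd b true (_ : (0 < h.+1 < r.+3)%N) => /(_ lt_h).
rewrite h_zero ?mul0n ?mul1n ?addn0; last by rewrite /between; lia.
move=> wE; split.
- split=> [||x]; [by rewrite pE mulrSr; ring|by []|].
  by rewrite (eq_upd p true cE) pE upd_tape.
- by lia.
- move=> j hj; rewrite ifF; last by move: hj; rewrite /between; lia.
  by apply: h_zero; move: hj; rewrite /between; lia.
- have : (h < 2 ^ h)%N by exact: ltn_expl.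
  by rewrite wE; move: h_t; rewrite !expnS; lia.
Qed.

(** A descending head reads a 1 only at the marker, and the two squares below it are cyclically the
    leading digits. Their weight is spent, so [t] is at least [18 * 2 ^ r - 5]. *)
Lemma inv_down_eat r (c : 'I_r.+3 -> bool) p t : c p -> c (p - 1) = false ->
  c (p - 2) = false -> inv_down c p t -> (2 ^ (r + 4) <= t + 3)%N.
Proof.
move=> cp c1 c2 [[s lt_s es]|[b [m [h [[pE b0 cE] lt_h h_zero h_t]]]]].
  by move: cp; rewrite es tape0.
have h0 : h = 0%N.
  case: h pE lt_h h_zero {h_t} => // h pE lt_h h_zero.
  by move: cp; rewrite cE pE tape_nat // h_zero // /between; lia.
move: pE; rewrite h0 addr0 => pE.
have b2 : b r.+2 = false.
  rewrite -(tape_nat m) // -cE -pE -c1; congr c; apply/eqP.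
  by rewrite eq_sym subr_eq -addrA -mulrSr natr_full addr0.
have b1 : b r.+1 = false.
  rewrite -(tape_nat m) // -cE -pE -c2; congr c; apply/eqP.
  by rewrite eq_sym subr_eq -addrA -natrD addn2 natr_full addr0.
have := weight_top b2 b1; have : (0 < 2 ^ r)%N by rewrite expn_gt0.
by move: h_t; rewrite h0 /budget addn4 !expnS expn0; lia.
Qed.

(** * Arbitrary words before the first merge *)

(** [PhaseMarked] anticipates the next move; [PhaseHold] and [PhaseDrop] keep the invariant from
    when the head read the 1; [PhaseCleared] needs none, since the next letter blocks or leaves a
    blank tape. *)
Inductive phase r : nat -> ('I_r.+3 -> state r) -> Prop :=
  | PhaseUp t (c : 'I_r.+3 -> bool) (p : 'I_r.+3) s of
      inv_up c p t & s =1 cfg (@up_state r) c p : phase t s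
  | PhaseDown t (c : 'I_r.+3 -> bool) (p : 'I_r.+3) s of
      inv_down c p t & s =1 cfg (@down_state r) c p : phase t s
  | PhaseMarked t (c : 'I_r.+3 -> bool) (p : 'I_r.+3) s of
      inv_down c (p + 1) t.+1 & s =1 cfg (@marked_state r) c p : phase t s
  | PhaseHold t (c : 'I_r.+3 -> bool) (p : 'I_r.+3) s of
      c (p + 2) & inv_down c (p + 2) t & s =1 cfg (@hold_state r) c p :
      phase t.+1 s
  | PhaseCleared t (c : 'I_r.+3 -> bool) (p : 'I_r.+3) s of
      s =1 cfg (@drop_state r false) c p : phase t s
  | PhaseDrop t (c : 'I_r.+3 -> bool) (p : 'I_r.+3) s of
      c (p + 4) & inv_down c (p + 4) t & s =1 cfg (@drop_state r true) c p :
      phase t.+2 s.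

Lemma phase_cell r t (s : 'I_r.+3 -> state r) :
  phase t s -> exists p, forall i, cell (s i) = p - i.
Proof.
case=> {}t c p {}s => [_|_|_|_ _||_ _] e; exists p => i; rewrite e /cfg.
- exact: cell_up.
- exact: cell_down.
- exact: cell_marked.
- exact: cell_hold.
- exact: cell_drop.
- exact: cell_drop.
Qed.

Lemma phase_not_const r t (s : 'I_r.+3 -> state r) q :
  phase t s -> (forall i, s i = q) -> False.
Proof.
move=> /phase_cell[p hp] sq; have := hp 0; have := hp 1.
by rewrite !sq => -> /addrI/oppr_inj/eqP; rewrite oner_eq0.
Qed.

Lemma drop_blocked r e (c : 'I_r.+3 -> bool) p : c (p + 3) || c (p + 2) ->
  exists i, move_step (cfg (@drop_state r e) c p i) = None.
Proof.
have e3 : p - (p + 3) = -3 by ring.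
have e2 : p - (p + 2) = -2 by ring.
have d34 : -3 - -4 = 1 :> 'I_r.+3 by ring.
have d23 : -2 - -3 = 1 :> 'I_r.+3 by ring.
have d24 : -2 - -4 = 2 :> 'I_r.+3 by ring.
have n34 : (-3 == -4 :> 'I_r.+3) = false by rewrite -subr_eq0 d34 oner_eq0.
have n23 : (-2 == -3 :> 'I_r.+3) = false by rewrite -subr_eq0 d23 oner_eq0.
have n24 : (-2 == -4 :> 'I_r.+3) = false by rewrite -subr_eq0 d24.
case: (boolP (c (p + 3))) => [c3 _|c3 /= c2].
  by exists (p + 3); rewrite /cfg /drop_state c3 e3 eqxx n34 andbF.
by exists (p + 2); rewrite /cfg /drop_state c2 e2 eqxx n23 n24 !andbF.
Qed.

Lemma drop_by_move r (c : 'I_r.+3 -> bool) p : c (p + 3) || c (p + 2) = false ->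
  leads r (cfg (@drop_state r false) c p) [:: mov]
    (cfg (@down_state r) (fun=> false) (p + 1)).
Proof.
move=> /norP[/negbTE c3 /negbTE c2] i.
have [E3 E2] : (c i && (p - i == -3)) = false /\ (c i && (p - i == -2)) = false.
  split; apply/andP => -[ci /eqP E].
    by move: c3; rewrite (_ : p + 3 = i) ?ci //; rewrite -[3]opprK -E; ring.
  by move: c2; rewrite (_ : p + 2 = i) ?ci //; rewrite -[2]opprK -E; ring.
rewrite /= /step /= /cfg /drop_state E3 E2 move_idle /=.
by congr (Some (down_state _ _)); ring.
Qed.

(** Departures from the forced run end in an undefined move, a blank tape, an early turn or the
    merge; only a move in [PhaseDrop] merges. *)
Lemma phase_step r t (s : 'I_r.+3 -> state r) a : phase t s ->
  [\/ exists i, step a (s i) = None,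
      exists2 s', leads r s [:: a] s' & phase t.+1 s' |
      (2 ^ (r + 4) <= t.+1)%N].
Proof.
have [->|->] : a = rst \/ a = mov.
  by case: a => -[|[|//]] h; [left|right]; apply: val_inj.
- case=> {}t c p {}s.
  + move=> h e; apply: Or32; exists (cfg (@marked_state r) (upd c p false) (p - 2)).
      exact: carries_ext (fsym e) (frefl _) (up_by_reset c p).
    apply: PhaseMarked (frefl _); rewrite (_ : p - 2 + 1 = p - 1); last by ring.
    exact: inv_up_turn.
  + move=> h e; apply: Or32; case cp: (c p).
      exists (cfg (@hold_state r) c (p - 2)).
        exact: carries_ext (fsym e) (frefl _) (down_by_reset1 cp).
      by apply: PhaseHold (frefl _); rewrite subrK.
    exists (cfg (@marked_state r) (upd c p true) (p - 2)).
      exact: carries_ext (fsym e) (frefl _) (down_by_reset0 cp).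
    apply: PhaseMarked (frefl _); rewrite (_ : p - 2 + 1 = p - 1); last by ring.
    exact: inv_down_fill.
  + move=> _ e; apply: Or32; exists (cfg (@drop_state r false) c (p - 2)).
      exact: carries_ext (fsym e) (frefl _) (marked_by_reset c p).
    exact: PhaseCleared (frefl _).
  + move=> cp h e; apply: Or32; exists (cfg (@drop_state r true) c (p - 2)).
      exact: carries_ext (fsym e) (frefl _) (hold_by_reset c p).
    by apply: PhaseDrop (frefl _); rewrite (_ : p - 2 + 4 = p + 2) //; ring.
  + move=> e; apply: Or32; exists (cfg (@marked_state r) (fun=> false) (p - 2)).
      exact: carries_ext (fsym e) (frefl _) (drop_by_reset false c p).
    exact: PhaseMarked (inv_down_blank _ _) (frefl _).
  + move=> _ _ e; apply: Or32; exists (cfg (@marked_state r) (fun=> false) (p - 2)).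
      exact: carries_ext (fsym e) (frefl _) (drop_by_reset true c p).
    exact: PhaseMarked (inv_down_blank _ _) (frefl _).
- case=> {}t c p {}s.
  + move=> h e; case cp: (c p).
      apply: Or31; exists p; rewrite e /step /= /cfg move_up.
      by rewrite cp subrr eqxx.
    apply: Or32; exists (cfg (@up_state r) c (p + 1)).
      exact: carries_ext (fsym e) (frefl _) (up_by_move cp).
    by apply: PhaseUp (frefl _); exact: inv_up_move.
  + move=> h e; case cp: (c p); last first.
      apply: Or31; exists p; rewrite e /step /= /cfg move_down.
      by rewrite cp subrr eqxx.
    apply: Or32; exists (cfg (@up_state r) c (p + 1)).
      exact: carries_ext (fsym e) (frefl _) (down_by_move cp).
    by apply: PhaseUp (frefl _); exact: inv_down_move.
  + move=> h e; apply: Or32; exists (cfg (@down_state r) c (p + 1)).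
      exact: carries_ext (fsym e) (frefl _) (marked_by_move c p).
    exact: PhaseDown h (frefl _).
  + move=> cp h e; apply: Or31; exists (p + 2); rewrite e /step /= /cfg /hold_state.
    by rewrite (_ : p - (p + 2) = -2) ?eqxx //; ring.
  + move=> e; case g: (c (p + 3) || c (p + 2)).
      by apply: Or31; have [i hi] := drop_blocked false g; exists i; rewrite e.
    apply: Or32; exists (cfg (@down_state r) (fun=> false) (p + 1)).
      exact: carries_ext (fsym e) (frefl _) (drop_by_move g).
    exact: PhaseDown (inv_down_blank _ _) (frefl _).
  + move=> cp h e; case g: (c (p + 3) || c (p + 2)).
      by apply: Or31; have [i hi] := drop_blocked true g; exists i; rewrite e.
    move: g; rewrite (_ : p + 3 = p + 4 - 1); last by ring.
    rewrite (_ : p + 2 = p + 4 - 2); last by ring.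
    (* No guard is set, so the tokens merge here. *)
    move=> /norP[/negbTE c3 /negbTE c2]; apply: Or33.
    by have := inv_down_eat cp c3 c2 h; rewrite addn3.
Qed.

Lemma phase_sync_size r w t (s : 'I_r.+3 -> state r) q : phase t s ->
  (forall i, run (@step r) (s i) w = Some q) -> (2 ^ (r + 4) <= t + size w)%N.
Proof.
elim: w t s => [|a w IH] t s ph hq.
  by case: (phase_not_const (q := q) ph) => i; have [] := hq i.
have [[i hi]|[s' lead ph']|le] := phase_step a ph.
- by have := hq i; rewrite /= hi.
- rewrite (_ : t + size (a :: w) = t.+1 + size w)%N; last by rewrite addSnnS.
  apply: (IH _ _ ph') => i.
  have := lead i; rewrite /= => hs; have := hq i; rewrite /=.
  by case: (step a (s i)) hs => //= x [->].
- by apply: leq_trans le _; rewrite -addn1 leq_add2l.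
Qed.

(** It suffices to follow the [idle] states, which form a blank configuration. *)
Lemma sync_size r w : syncs (@step r) w -> (2 ^ (r + 4) <= size w)%N.
Proof.
move=> [q hq]; rewrite -[size w]add0n.
apply: (@phase_sync_size r w 0 (cfg (@marked_state r) (fun=> false) 0) q) => [|i].
  exact: PhaseMarked (inv_down_blank _ _) (frefl _).
exact: hq.
Qed.

Local Close Scope ring_scope.

Theorem theorem3 (n k : nat) :
  0 < k -> n = 6 * k + 4 -> 2 ^ ((n - 4) %/ 3) <= car n 2.
Proof.
move=> k_gt0 nE; have -> : (n - 4) %/ 3 = 2 * k by rewrite nE; lia.
(* For [k = 1] the ring would have one cell, but [n - 1 = 9] suffices. Otherwise [r = 2k - 4] in the
   original [k] gives [3 * (2k - 1) + 7 = n] states and [r + 4 = 2k]. *)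
case: k k_gt0 nE => [//|[|k]] _ nE.
  by apply: leq_trans (car_ge_pred n _); rewrite ?nE.
apply: (car_lower_bound (T := state k.*2) (step := @step _)).
- by rewrite card_state nE; lia.
- by apply: sync_exists; rewrite odd_double.
- by move=> w /sync_size; congr (2 ^ _ <= _); lia.
Qed.
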